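(* Let $R$ and $S$ be countably infinite semiprimitive principal ideal domains that are not fields. Then the Macías spaces $M(R)$ and $M(S)$ are homeomorphic if and only if their groups of units have the same cardinality, $|U(R)| = |U(S)|$.
   Context: For a commutative integral domain $R$ with $1 \neq 0$, write $R^0 = R \setminus \{0\}$. For $k \in R^0$ let $\sigma_k^0 := \{s \in R^0 : \langle k \rangle + \langle s \rangle = R\}$, where $\langle k \rangle$ is the principal ideal generated by $k$. The sets $\sigma_k^0$ ($k \in R^0$) form a basis of a topology on $R^0$; the Macías space $M(R)$ is the set $R^0$ with this topology. The Jacobson radical $\mathfrak{J}(R)$ is the intersection of all maximal ideals of $R$, and $R$ is semiprimitive if $\mathfrak{J}(R) = \{0\}$. *)

(* Defs.v *)
From HB Require Import structures.
From mathcomp Require Import all_boot all_order all_algebra.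
From mathcomp Require Import boolp classical_sets functions cardinality.
From mathcomp Require Import topology.

Set Implicit Arguments.
Unset Strict Implicit.
Unset Printing Implicit Defensive.

Import GRing.Theory.

Local Open Scope ring_scope.
Local Open Scope classical_set_scope.

Definition is_ideal (R : idomainType) (I : set R) : Prop :=
  [/\ I 0,
      forall a b : R, I a -> I b -> I (a + b)
    & forall r a : R, I a -> I (r * a)].

Definition principal_ideal (R : idomainType) (k : R) : set R :=
  [set r * k | r in [set: R]].

Definition ideal_sum (R : idomainType) (I J : set R) : set R :=
  [set a + b | a in I & b in J].

Definition is_PID (R : idomainType) : Prop :=
  forall I : set R, is_ideal I -> exists k : R, I = principal_ideal k.

Definition maximal_ideal (R : idomainType) (M : set R) : Prop :=
  [/\ is_ideal M,
      M <> setT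
    & forall J : set R, is_ideal J -> M `<=` J -> J = M \/ J = setT].

Definition jacobson_radical (R : idomainType) : set R :=
  \bigcap_(M in [set M : set R | maximal_ideal M]) M.

Arguments jacobson_radical R : clear implicits.

Definition semiprimitive (R : idomainType) : Prop :=
  jacobson_radical R = [set 0].

Definition macias (R : idomainType) : Type := {x : R | x != 0}.

HB.instance Definition _ (R : idomainType) := Choice.on (macias R).

(* isBaseTopological requires a pointed type of indices for the base. *)
HB.instance Definition _ (R : idomainType) :=
  isPointed.Build (macias R) (exist _ 1 (oner_neq0 R)).

Definition sigma0 (R : idomainType) (k : macias R) : set (macias R) :=
  [set s | ideal_sum (principal_ideal (val k)) (principal_ideal (val s)) = setT].

Section MaciasTopology.
Context (R : idomainType).

Lemma sigma0P (k s : macias R) :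
  sigma0 k s <-> exists a b : R, a * val k + b * val s = 1.
Proof.
split=> [E|[a [b E]]].
  have: ideal_sum (principal_ideal (val k)) (principal_ideal (val s)) 1.
    by rewrite E.
  by case=> _ [a _ <-] [_ [b _ <-] E1]; exists a, b.
apply/seteqP; split=> // x _.
exists (x * a * val k); first by exists (x * a).
exists (x * b * val s); first by exists (x * b).
by rewrite -!mulrA -mulrDr E mulr1.
Qed.

Lemma sigma0_cover : \bigcup_(k in [set: macias R]) sigma0 k = setT.
Proof.
apply/seteqP; split=> // s _; exists (exist _ 1 (oner_neq0 R)) => //.
by apply/sigma0P; exists 1, 0; rewrite mulr1 mul0r addr0.
Qed.

Lemma sigma0_join (k l s : macias R) :
  [set: macias R] k -> [set: macias R] l -> sigma0 k s -> sigma0 l s ->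
  exists m : macias R,
    [/\ [set: macias R] m, sigma0 m s & sigma0 m `<=` sigma0 k `&` sigma0 l].
Proof.
move=> _ _ /sigma0P[a [b E]] /sigma0P[c [d F]].
exists (exist _ (val k * val l) (mulf_neq0 (valP k) (valP l))); split=> //.
- apply/sigma0P; exists (a * c), (a * val k * d + b) => /=.
  have -> : a * c * (val k * val l) + (a * val k * d + b) * val s =
            a * val k * (c * val l + d * val s) + b * val s.
    by rewrite mulrACA mulrDl mulrDr addrA !mulrA.
  by rewrite F mulr1.
- move=> t /sigma0P[x [y /= G]]; split; apply/sigma0P.
  + by exists (x * val l), y; rewrite -G (mulrC (val k)) mulrA.
  + by exists (x * val k), y; rewrite -G mulrA.
Qed.

HB.instance Definition _ :=
  isBaseTopological.Build (macias R) sigma0_cover sigma0_join.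

End MaciasTopology.

Definition homeomorphic (X Y : topologicalType) : Prop :=
  exists (f : X -> Y) (g : Y -> X),
    [/\ cancel f g, cancel g f, continuous f & continuous g].

(* Main.v *)
Require Import Defs.
From HB Require Import structures.
From mathcomp Require Import all_boot all_order all_algebra.
From mathcomp Require Import boolp classical_sets functions cardinality.
From mathcomp Require Import topology.

(* A nonzero element s of a PID has a finite set P(s) of prime divisors up to
   associates, and t lies in sigma_k^0 iff P(k) and P(t) are disjoint; so the
   topology only sees P.  In the countable semiprimitive case there are
   countably infinitely many primes, every finite set of primes is some P(s),
   and the fibres of P are the units (over the empty set) or countably infinite
   (they contain all powers of s).  Hence, identifying the primes of R and S with
   nat, fibrewise bijections glue to a homeomorphism as soon as the unit groups
   are equipotent.  Conversely the units are the points that lie in every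
   nonempty open set. *)

Set Implicit Arguments.
Unset Strict Implicit.
Unset Printing Implicit Defensive.

Import GRing.Theory.

Local Open Scope ring_scope.
Local Open Scope classical_set_scope.
Local Open Scope card_scope.

(** * Gluing bijections between fibres *)

Lemma fibrewise_bijection (X : Type) (Y : pointedType) (T : Type)
    (p : X -> T) (q : Y -> T) :
  (forall t, p @^-1` [set t] #= q @^-1` [set t]) ->
  exists (f : X -> Y) (g : Y -> X),
    [/\ cancel f g, cancel g f & forall x, q (f x) = p x].
Proof.
move=> pq.
have /choice[h hP] t : exists h : X -> Y,
    set_bij (p @^-1` [set t]) (q @^-1` [set t]) h by apply/card_set_bijP.
have qh x : q (h (p x) x) = p x by have [+ _ _] := hP (p x); apply.
have /choice[g gP] y : exists x, h (p x) x = y.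
  have [_ _ /(_ y erefl)[x /= px hx]] := hP (q y).
  by exists x; rewrite px.
exists (fun x => h (p x) x), g; split=> // x.
(* Both [x] and [g (h (p x) x)] lie in the fibre over [p x], where [h (p x)] is injective and takes
   the same value at both. *)
have E := gP (h (p x) x).
have pg : p (g (h (p x) x)) = p x by rewrite -[LHS]qh E qh.
have [_ inj _] := hP (p x).
by apply: inj; rewrite ?inE //= -[RHS]E pg.
Qed.

(** * Divisibility and prime elements in a domain *)

Section Divisibility.
Variable R : idomainType.
Implicit Types (a b d p q s x : R) (n : nat).

Definition divides a b := exists c, b = c * a.

Lemma principal_idealE a b : principal_ideal a b <-> divides a b.
Proof. by split=> [[c _ <-]|[c ->]]; exists c. Qed.

Lemma divides_refl a : divides a a.
Proof. by exists 1; rewrite mul1r. Qed.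

Lemma divides_trans a b d : divides a b -> divides b d -> divides a d.
Proof. by move=> [c ->] [e ->]; exists (e * c); rewrite mulrA. Qed.

Lemma divides_mull a b d : divides a b -> divides a (d * b).
Proof. by move=> [c ->]; exists (d * c); rewrite mulrA. Qed.

Lemma divides_mulr a b d : divides a b -> divides a (b * d).
Proof. by rewrite mulrC; exact: divides_mull. Qed.

Lemma divides_add a b d : divides a b -> divides a d -> divides a (b + d).
Proof. by move=> [c ->] [e ->]; exists (c + e); rewrite mulrDl. Qed.

Lemma divides_unit a b : divides a b -> b \is a GRing.unit ->
  a \is a GRing.unit.
Proof. by move=> [c ->]; rewrite unitrM => /andP[]. Qed.

Lemma principal_ideal_is_ideal a : is_ideal (principal_ideal a).
Proof.
split.
- by exists 0; rewrite ?mul0r.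
- by move=> x y /principal_idealE ax /principal_idealE ay;
    apply/principal_idealE/divides_add.
- by move=> r x /principal_idealE ax; apply/principal_idealE/divides_mull.
Qed.

Lemma combination_is_ideal a b :
  is_ideal [set x | exists u v, x = u * a + v * b].
Proof.
split.
- by exists 0, 0; rewrite !mul0r addr0.
- move=> _ _ [u [v ->]] [u' [v' ->]]; exists (u + u'), (v + v').
  by rewrite !mulrDl addrACA.
- by move=> r _ [u [v ->]]; exists (r * u), (r * v); rewrite mulrDr !mulrA.
Qed.

Lemma is_ideal_divides (I : set R) a b :
  is_ideal I -> I a -> divides a b -> I b.
Proof. by move=> [_ _ IM] Ia [c ->]; apply: IM. Qed.

Lemma is_ideal_unit (I : set R) u :
  is_ideal I -> u \is a GRing.unit -> I u -> I = setT.
Proof.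
move=> idI uu Iu; apply/seteqP; split=> // x _.
by apply: is_ideal_divides idI Iu _; exists (x / u); rewrite divrK.
Qed.

(* [p] is nonzero and generates a maximal ideal. *)
Definition prime_elt p :=
  [/\ p != 0, p \isn't a GRing.unit &
      forall x, divides p x \/ exists a b, a * p + b * x = 1].

(** If [p] does not divide [a], multiplying [u * p + v * a = 1] by [b] writes [b] as a sum of
    multiples of [p] and [a * b]. *)
Lemma prime_elt_mul p a b : prime_elt p ->
  divides p (a * b) -> divides p a \/ divides p b.
Proof.
move=> [_ _ maxp] pab; have [|[u [v E]]] := maxp a; [by left|right].
rewrite -(mul1r b) -E mulrDl -mulrA (mulrC p) -(mulrA v).
by apply: divides_add; [do 2 apply: divides_mull; apply: divides_refl|
                        apply: divides_mull].
Qed.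

Lemma prime_elt_divides1 p : prime_elt p -> ~ divides p 1.
Proof. by move=> [_ /negP pN _] /divides_unit/(_ (unitr1 R)). Qed.

Lemma prime_elt_exp p a n : prime_elt p -> divides p (a ^+ n) -> divides p a.
Proof.
move=> pp; elim: n => [|n IHn]; first by rewrite expr0 => /prime_elt_divides1.
by rewrite exprS => /prime_elt_mul[].
Qed.

(** Otherwise [a * q + b * p = 1], and [p], dividing both terms, would divide 1. *)
Lemma prime_elt_divides_sym p q : prime_elt p -> prime_elt q ->
  divides p q -> divides q p.
Proof.
move=> pp [_ _ maxq] pq; have [//|[a [b E]]] := maxq p.
case: (prime_elt_divides1 pp); rewrite -E.
by apply: divides_add; apply: divides_mull => //; apply: divides_refl.
Qed.

(** * Prime divisors in a principal ideal domain *)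

Hypothesis R_PID : is_PID R.

Lemma bezout a b : exists d,
  [/\ divides d a, divides d b & exists u v, d = u * a + v * b].
Proof.
have [d E] := R_PID (combination_is_ideal a b); exists d; split.
- by apply/principal_idealE; rewrite -E; exists 1, 0; rewrite mul1r mul0r addr0.
- by apply/principal_idealE; rewrite -E; exists 0, 1; rewrite mul1r mul0r add0r.
- have : principal_ideal d d by apply/principal_idealE/divides_refl.
  by rewrite -E.
Qed.

Definition strictly_divides a b := divides a b /\ ~ divides b a.

(* The union of the ideals generated by an infinite descending chain of
   divisors would be an ideal without generator. *)
Lemma strictly_divides_wf : well_founded strictly_divides.
Proof.
move=> s0; apply: contrapT => s0N.
pose bad := {s | ~ Acc strictly_divides s}.
(* An inaccessible element has an inaccessible strict divisor; iterating the choice [f] gives the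
   chain [c]. *)
have /choice[f fP] (s : bad) :
    exists t : bad, strictly_divides (sval t) (sval s).
  case: s => s sN /=; apply: contrapT => no; apply: sN; constructor=> t ts.
  by apply: contrapT => tN; apply: no; exists (exist _ t tN).
pose c n := sval (iter n f (exist _ s0 s0N)).
have cS n : strictly_divides (c n.+1) (c n) by apply: fP.
have cD m n : divides (c (m + n)%N) (c m).
  elim: n => [|n IHn]; first by rewrite addn0; apply: divides_refl.
  by rewrite addnS; have [+ _] := cS (m + n)%N => /divides_trans; apply.
have idI : is_ideal [set x | exists n, divides (c n) x].
  split.
  - by exists 0%N, 0; rewrite mul0r.
  - move=> a b [m ma] [n nb]; exists (m + n)%N; apply: divides_add.
      exact: divides_trans (cD _ _) ma.
    by apply: divides_trans nb; rewrite addnC.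
  - by move=> r a [n na]; exists n; apply: divides_mull.
have [d E] := R_PID idI.
have : principal_ideal d d by apply/principal_idealE/divides_refl.
(* The generator [d] is a multiple of some [c n] and divides [c n.+1], so [c n] divides [c n.+1],
   against strictness. *)
rewrite -E => -[n nd]; case: (cS n) => _; apply; apply: divides_trans nd _.
by apply/principal_idealE; rewrite -E; exists n.+1; apply: divides_refl.
Qed.

(** Induction along strict divisors: if [s] is not prime, some [x] is neither a multiple of [s] nor
    comaximal with it, and the gcd of [s] and [x] is a nonunit strict divisor of [s]. *)
Lemma exists_prime_divisor s : s != 0 -> s \isn't a GRing.unit ->
  exists2 p, prime_elt p & divides p s.
Proof.
elim/(well_founded_ind strictly_divides_wf): s => s IH s0 sN.
have [ps|] := pselect (prime_elt s); first by exists s => //; apply: divides_refl.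
move=> /not_and3P[//|//|/existsNP[x /not_orP[sx nb]]].
have [d [ds dx [u [v E]]]] := bezout s x.
have [|||p pp pd] := IH d.
- by split=> // sd; apply: sx; apply: divides_trans sd dx.
- by apply: contraNneq s0 => d0; case: ds => c ->; rewrite d0 mulr0.
- apply/negP => du; apply: nb; exists (d^-1 * u), (d^-1 * v).
  by rewrite -!mulrA -mulrDr -E mulVr.
by exists p => //; apply: divides_trans pd ds.
Qed.

Lemma prime_elt_prod p (r : seq R) : prime_elt p ->
  divides p (\prod_(x <- r) x) -> exists2 x, x \in r & divides p x.
Proof.
move=> pp; elim: r => [|x r IHr].
  by rewrite big_nil => /(prime_elt_divides1 pp).
rewrite big_cons => /(prime_elt_mul pp)[px|/IHr[y yr py]].
  by exists x; rewrite ?mem_head.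
by exists y; rewrite // inE yr orbT.
Qed.

Lemma divides_prod x (r : seq R) : x \in r -> divides x (\prod_(y <- r) y).
Proof.
by move=> xr; rewrite (big_rem x) //=; apply/divides_mulr/divides_refl.
Qed.

Lemma prime_elt_associate p q :
  divides p q -> divides q p -> prime_elt p -> prime_elt q.
Proof.
move=> pq qp [p0 pN maxp]; have [c pE] := qp; split.
- by apply: contraNneq p0 => q0; rewrite pE q0 mulr0.
- by apply: contraNN pN; apply: divides_unit.
- move=> x; have [px|[a [b E]]] := maxp x; first by left; apply: divides_trans px.
  by right; exists (a * c), b; rewrite -mulrA -pE.
Qed.

(** The choice depends only on the set of associates, so associates share a representative. The
    default 0 is never a fallback, as [p] is its own associate. *)
Definition associate_rep p := xget 0 [set q | divides p q /\ divides q p].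

Definition prime_reps := [set p | prime_elt p /\ associate_rep p = p].

Lemma associate_repP p :
  divides p (associate_rep p) /\ divides (associate_rep p) p.
Proof.
by apply: (@xgetI _ 0 [set q | divides p q /\ divides q p] p);
  split; apply: divides_refl.
Qed.

Lemma eq_associate_rep p q : divides p q -> divides q p ->
  associate_rep p = associate_rep q.
Proof.
move=> pq qp; congr (xget 0 _); apply/seteqP; split=> x /= [h1 h2].
  by split; [apply: divides_trans h1|apply: divides_trans pq].
by split; [apply: divides_trans h1|apply: divides_trans qp].
Qed.

Lemma prime_reps_associate_rep p : prime_elt p -> prime_reps (associate_rep p).
Proof.
move=> pp; have [pr rp] := associate_repP p; split.
  exact: prime_elt_associate pp.
exact: eq_associate_rep.
Qed.

Lemma prime_reps_divisor s : s != 0 -> s \isn't a GRing.unit ->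
  exists2 q, prime_reps q & divides q s.
Proof.
move=> s0 /(exists_prime_divisor s0)[p pp ps].
exists (associate_rep p); first exact: prime_reps_associate_rep.
by have [_ rp] := associate_repP p; apply: divides_trans ps.
Qed.

Lemma prime_reps_inj p q : prime_reps p -> prime_reps q ->
  divides p q -> p = q.
Proof.
move=> [pp pE] [qq qE] pq; rewrite -pE -qE; apply: eq_associate_rep => //.
exact: prime_elt_divides_sym.
Qed.

(** * Infinitely many primes *)

Hypothesis R_semiprimitive : semiprimitive R.
Hypothesis R_not_field : ~ GRing.field_axiom R.

(* Otherwise the product of all primes would be a nonzero element of the
   Jacobson radical. *)
Lemma infinite_prime_reps : ~ finite_set prime_reps.
Proof.
move=> finQ; pose P := \prod_(q <- finmap.enum_fset (fset_set prime_reps)) q.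
have P0 : P != 0.
  rewrite prodf_seq_neq0; apply/allP => q.
  by rewrite in_fset_set // inE /= => -[[]].
suff : jacobson_radical R P by rewrite R_semiprimitive => /eqP; apply/negP.
move=> M [idM MT maxM]; have [m ME] := R_PID idM.
have mN : m \isn't a GRing.unit.
  apply/negP => mu; apply: MT; apply: is_ideal_unit idM mu _.
  by rewrite ME; apply/principal_idealE/divides_refl.
have [q Qq qm] : exists2 q, prime_reps q & divides q m.
  (* If [M] is the zero ideal, any prime divides [m]; one exists because a domain that is not a
     field has a nonzero nonunit. *)
  have [->|m0] := eqVneq m 0; last exact: prime_reps_divisor.
  have /existsNP[x /not_implyP[x0 /negP xN]] := R_not_field.
  have [q Qq _] := prime_reps_divisor x0 xN.
  by exists q => //; exists 0; rewrite mul0r.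
have Mq : M `<=` principal_ideal q.
  move=> x; rewrite ME => /principal_idealE mx.
  by apply/principal_idealE; apply: divides_trans mx.
have [<-|qT] := maxM _ (principal_ideal_is_ideal q) Mq.
  apply/principal_idealE/divides_prod; rewrite in_fset_set ?inE //.
have : principal_ideal q 1 by rewrite qT.
by case: Qq => qq _ /principal_idealE/(prime_elt_divides1 qq).
Qed.

(** The chosen primes form a countable infinite set, hence one equipotent to [nat]. *)
Lemma prime_enumeration : countable [set: R] ->
  exists p : nat -> R,
    [/\ forall i, prime_elt (p i),
        forall i j, divides (p i) (p j) -> i = j &
        forall s, s != 0 -> s \isn't a GRing.unit ->
          exists i, divides (p i) s].
Proof.
move=> cR; have cQ : countable prime_reps.
  by apply: sub_countable cR; apply: subset_card_le.
have /card_set_bijP[f [_ finj fsurj]] := eq_card_nat cQ infinite_prime_reps.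
have /choice[p pP] i : exists q, prime_reps q /\ f q = i.
  by have [q Qq fq] := fsurj i I; exists q.
exists p; split.
- by move=> i; have [[]] := pP i.
- move=> i j ij; have [Qi fi] := pP i; have [Qj fj] := pP j.
  by rewrite -fi -fj (prime_reps_inj Qi Qj ij).
- move=> s s0 sN; have [q Qq qs] := prime_reps_divisor s0 sN.
  exists (f q); have [Qp fp] := pP (f q).
  by have -> : p (f q) = q by apply: finj; rewrite ?inE.
Qed.

End Divisibility.

(** * Prime supports and their fibres *)

Section PrimeSupport.
Variables (R : idomainType) (p : nat -> R).
Hypothesis R_PID : is_PID R.
Hypothesis p_prime : forall i, prime_elt (p i).
Hypothesis p_inj : forall i j, divides (p i) (p j) -> i = j.
Hypothesis p_divisor : forall s : R, s != 0 -> s \isn't a GRing.unit ->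
  exists i, divides (p i) s.

(** Indices replace primes so that the supports for [R] and [S] live in the same type. *)
Definition prime_support (s : macias R) := [set i | divides (p i) (val s)].

Lemma prime_support_eq0 (s : macias R) :
  prime_support s = set0 <-> val s \is a GRing.unit.
Proof.
split=> [s0|su].
  apply: contrapT => /negP/(p_divisor (valP s))[i si].
  by have : prime_support s i by []; rewrite s0.
apply/seteqP; split=> // i /= /divides_unit/(_ su).
by have [_ /negP] := p_prime i.
Qed.

(** Induction along strict divisors: if [s = t * p i], every [p j] dividing [s] divides [t] or is
    [p i]. *)
Lemma finite_prime_support (s : macias R) : finite_set (prime_support s).
Proof.
rewrite /prime_support; case: s => s /=.
elim/(well_founded_ind (strictly_divides_wf R_PID)): s => s IH s0.
have [su|/(p_divisor s0)[i [t sE]]] := boolP (s \is a GRing.unit).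
  have := @prime_support_eq0 (exist _ s s0); rewrite /prime_support /=.
  by move=> [_ ->].
have t0 : t != 0 by apply: contraNneq s0 => t0; rewrite sE t0 mul0r.
have ts : strictly_divides t s.
  split=> [|[c tE]]; first by rewrite sE; apply/divides_mulr/divides_refl.
  have [_ /negP + _] := p_prime i; apply; apply/unitrPr; exists c.
  by apply: (mulfI t0); rewrite mulrA -sE mulr1 mulrC -tE.
have fin : finite_set ([set i] `|` [set j | divides (p j) t]).
  by rewrite finite_setU; split; [exact: finite_set1|exact: IH].
apply: sub_finite_set fin => j /=; rewrite sE => /(prime_elt_mul (p_prime j)).
by case=> [|/p_inj ->]; [right|left].
Qed.

(** The product of the [p i] with [i] in [A] works, since a prime dividing a product divides a
    factor. *)
Lemma prime_support_surj (A : set nat) : finite_set A ->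
  exists s : macias R, prime_support s = A.
Proof.
move=> finA.
pose r := [seq p i | i <- finmap.enum_fset (fset_set A)].
have s0 : \prod_(x <- r) x != 0.
  rewrite prodf_seq_neq0; apply/allP => _ /mapP[i _ ->].
  by have [] := p_prime i.
exists (exist (fun x => x != 0) _ s0); apply/seteqP; split=> i /=.
  move=> /(prime_elt_prod (p_prime i))[_ /mapP[j jA ->] /p_inj ->].
  by move: jA; rewrite in_fset_set // inE.
by move=> Ai; apply: divides_prod; apply: map_f; rewrite in_fset_set // inE.
Qed.

(** A common prime would divide 1. Conversely, a nonunit gcd would have a prime divisor in both
    supports, and a unit gcd rescales to 1. *)
Lemma sigma0_prime_support (k s : macias R) :
  sigma0 k s <-> prime_support k `&` prime_support s = set0.
Proof.
split=> [/sigma0P[a [b E]]|ks].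
  apply/seteqP; split=> // i [/= ik is_]; apply: (prime_elt_divides1 (p_prime i)).
  by rewrite -E; apply: divides_add; apply: divides_mull.
have [d [dk ds [u [v E]]]] := bezout R_PID (val k) (val s).
have d0 : d != 0.
  by apply: contraNneq (valP s) => d0; case: ds => c ->; rewrite d0 mulr0.
apply/sigma0P; have [du|/(p_divisor d0)[i id]] := boolP (d \is a GRing.unit).
  by exists (d^-1 * u), (d^-1 * v); rewrite -!mulrA -mulrDr -E mulVr.
have : (prime_support k `&` prime_support s) i.
  by split; apply: divides_trans id _.
by rewrite ks.
Qed.

Lemma prime_support_exp (s : macias R) n (sn0 : val s ^+ n.+1 != 0) :
  prime_support (exist (fun x => x != 0) _ sn0) = prime_support s.
Proof.
rewrite /prime_support /=.
apply/seteqP; split=> i /=; first exact: prime_elt_exp.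
by rewrite exprS; apply: divides_mulr.
Qed.

(** Cancelling in [s ^+ m = s ^+ n] with [n < m] gives [s ^+ (m - n) = 1], making [s] a unit. *)
Lemma exp_inj_nonunit (s : R) : s != 0 -> s \isn't a GRing.unit ->
  injective (fun n => s ^+ n).
Proof.
move=> s0 sN.
suff W m n : s ^+ m = s ^+ n -> (m <= n)%N.
  by move=> m n /= E; apply/eqP; rewrite eqn_leq !W.
move=> E; rewrite leqNgt; apply/negP => nm; case/negP: sN.
apply/unitrPr; exists (s ^+ (m - n).-1).
apply: (mulfI (expf_neq0 n s0)).
by rewrite -exprS prednK ?subn_gt0 // -exprD subnKC ?mulr1 // ltnW.
Qed.

(** The powers of one [s] with support [A] are distinct, because [A] is nonempty and so [s] is not a
    unit. *)
Lemma prime_support_fibre (A : set nat) : countable [set: R] ->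
  finite_set A -> A <> set0 -> prime_support @^-1` [set A] #= [set: nat].
Proof.
move=> cR finA A0; apply: eq_card_nat.
  have /countable_injP[f finj] := cR; apply/countable_injP.
  exists (f \o val) => x y _ _ /finj E.
  by apply: val_inj; apply: E; rewrite inE.
have [s sA] := prime_support_surj finA.
have sN : val s \isn't a GRing.unit.
  by apply/negP => /prime_support_eq0; rewrite sA.
(* Exponents start at 1, as [s ^+ 0 = 1] has empty support. *)
pose f n : macias R :=
  exist (fun x => x != 0) _ (expf_neq0 n.+1 (valP s)).
apply/infiniteP; apply: (@card_le_trans _ _ _ (range f)).
  have /card_esym/card_eqPle[] // : range f #= [set: nat].
  apply: inj_card_eq => m n _ _ /(congr1 val).
  by move=> /(exp_inj_nonunit (valP s) sN)[].
by apply: subset_card_le => _ [n _ <-]; rewrite /= prime_support_exp.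
Qed.

End PrimeSupport.

(** * Basic open sets and invariance of the units *)

Lemma sigma0_open (R : idomainType) (k : macias R) : open (sigma0 k).
Proof. by exists [set k] => //; rewrite bigcup_set1. Qed.

Lemma open_sigma0 (R : idomainType) (A : set (macias R)) (x : macias R) :
  open A -> A x -> exists2 k, sigma0 k x & sigma0 k `<=` A.
Proof.
move=> [D _ <-] [k Dk kx]; exists k => // y ky; exact: (bigcup_sup Dk).
Qed.

Lemma continuous_macias (X : topologicalType) (R : idomainType)
    (f : X -> macias R) :
  (forall k, open (f @^-1` sigma0 k)) -> continuous f.
Proof.
move=> fk; apply/continuousP => _ [D _ <-].
by rewrite preimage_bigcup; apply: bigcup_open => k _; apply: fk.
Qed.

Lemma unit_sigma0 (R : idomainType) (k u : macias R) :
  val u \is a GRing.unit -> sigma0 k u.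
Proof.
by move=> uu; apply/sigma0P; exists 0, (val u)^-1; rewrite mul0r add0r mulVr.
Qed.

Lemma sigma0_unit (R : idomainType) (u : macias R) :
  sigma0 u u -> val u \is a GRing.unit.
Proof.
by move=> /sigma0P[a [b E]]; apply/unitrPr; exists (a + b); rewrite mulrC mulrDl.
Qed.

(** The open preimage of [sigma0 (f u)] contains [g 1], hence a nonempty basic open set, hence the
    unit [u]. So [f u] is comaximal with itself. *)
Lemma homeomorphism_unit (R S : idomainType) (f : macias R -> macias S)
    (g : macias S -> macias R) (u : macias R) :
  cancel g f -> continuous f ->
  val u \is a GRing.unit -> val (f u) \is a GRing.unit.
Proof.
move=> gK fc uu; apply: sigma0_unit.
have : open (f @^-1` sigma0 (f u)).
  by move/continuousP: fc; apply; apply: sigma0_open.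
pose e : macias S := exist _ 1 (oner_neq0 S).
move=> /(open_sigma0 (x := g e))[|k _ kf].
  by rewrite /= gK; apply: unit_sigma0; apply: unitr1.
exact/kf/unit_sigma0.
Qed.

Lemma card_units_macias (R : idomainType) :
  [set u : macias R | val u \is a GRing.unit] #=
  [set u : R | u \is a GRing.unit].
Proof.
have -> : [set u : R | u \is a GRing.unit] =
    val @` [set u : macias R | val u \is a GRing.unit].
  apply/seteqP; split=> [u uu|_ [u uu <-] //].
  have u0 : u != 0 by apply: contraTneq uu => ->; rewrite unitr0.
  by exists (exist _ u u0).
by apply/card_esym/inj_card_eq => x y _ _ /val_inj.
Qed.

Lemma homeomorphic_card_units (R S : idomainType) :
  homeomorphic (macias R) (macias S) ->
  [set u : R | u \is a GRing.unit] #= [set u : S | u \is a GRing.unit].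
Proof.
move=> [f [g [fK gK fc gc]]].
apply: card_eq_trans (card_units_macias S).
apply: card_eq_trans (card_esym (card_units_macias R)) _.
have -> : [set u : macias S | val u \is a GRing.unit] =
    f @` [set u : macias R | val u \is a GRing.unit].
  apply/seteqP; split=> [u uu|_ [u uu <-]].
    by exists (g u) => //; apply: homeomorphism_unit fK gc uu.
  exact: homeomorphism_unit gK fc uu.
by apply/card_esym/inj_card_eq => x y _ _ /(can_inj fK).
Qed.

(** * Homeomorphisms from support-preserving bijections *)

(** Since [sigma0 k] depends only on the support of [k], its preimage is [sigma0 k'] for any [k']
    with the same support. *)
Lemma prime_support_continuous (R S : idomainType) (p : nat -> R)
    (q : nat -> S) (f : macias R -> macias S) :
  (forall k s, sigma0 k s <-> prime_support p k `&` prime_support p s = set0) ->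
  (forall k s, sigma0 k s <-> prime_support q k `&` prime_support q s = set0) ->
  (forall k, exists k', prime_support p k' = prime_support q k) ->
  (forall x, prime_support q (f x) = prime_support p x) ->
  continuous f.
Proof.
move=> Rp Sq surj fE; apply: continuous_macias => k; have [k' kE] := surj k.
suff -> : f @^-1` sigma0 k = sigma0 k' by apply: sigma0_open.
by apply/seteqP; split=> x /=; rewrite Rp Sq fE kE.
Qed.

Theorem corollary4p2 (R S : idomainType)
    (R_countably_infinite : [set: R] #= [set: nat])
    (S_countably_infinite : [set: S] #= [set: nat])
    (R_semiprimitive : semiprimitive R)
    (S_semiprimitive : semiprimitive S)
    (R_PID : is_PID R)
    (S_PID : is_PID S)
    (R_not_field : ~ GRing.field_axiom R)
    (S_not_field : ~ GRing.field_axiom S) :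
  homeomorphic (macias R) (macias S) <->
  [set u : R | u \is a GRing.unit] #= [set u : S | u \is a GRing.unit].
Proof.
split; first exact: homeomorphic_card_units.
move=> units.
have cR : countable [set: R] by case/card_eqPle: R_countably_infinite.
have cS : countable [set: S] by case/card_eqPle: S_countably_infinite.
have [p [pp pinj pdiv]] := prime_enumeration R_PID R_semiprimitive R_not_field cR.
have [q [qq qinj qdiv]] := prime_enumeration S_PID S_semiprimitive S_not_field cS.
have psurj k : exists k', prime_support p k' = prime_support q k.
  exact/(prime_support_surj pp pinj)/finite_prime_support.
have qsurj k : exists k', prime_support q k' = prime_support p k.
  exact/(prime_support_surj qq qinj)/finite_prime_support.
(* The fibres over [A] are the units if [A] is empty, countably infinite if [A] is finite and
   nonempty, and empty if [A] is infinite. *)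
have /fibrewise_bijection[f [g [fK gK fE]]] A :
    prime_support p @^-1` [set A] #= prime_support q @^-1` [set A].
  have [->|A0] := pselect (A = set0).
    have -> : prime_support p @^-1` [set set0] =
        [set u : macias R | val u \is a GRing.unit].
      by apply/seteqP; split=> u /(prime_support_eq0 pp pdiv).
    have -> : prime_support q @^-1` [set set0] =
        [set u : macias S | val u \is a GRing.unit].
      by apply/seteqP; split=> u /(prime_support_eq0 qq qdiv).
    apply: card_eq_trans (card_units_macias R) _.
    exact: card_eq_trans units (card_esym (card_units_macias S)).
  have [finA|infA] := pselect (finite_set A).
    apply: card_eq_trans (prime_support_fibre pp pinj pdiv cR finA A0) _.
    exact/card_esym/(prime_support_fibre qq qinj qdiv cS finA A0).
  have -> : prime_support p @^-1` [set A] = set0.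
    by apply/seteqP; split=> // s sA; apply: infA; rewrite -sA;
      apply: finite_prime_support.
  have -> : prime_support q @^-1` [set A] = set0.
    by apply/seteqP; split=> // s sA; apply: infA; rewrite -sA;
      apply: finite_prime_support.
  by rewrite card_eq0.
have gE y : prime_support p (g y) = prime_support q y by rewrite -fE gK.
have Rp := sigma0_prime_support R_PID pp pdiv.
have Sq := sigma0_prime_support S_PID qq qdiv.
exists f, g; split=> //.
- exact: prime_support_continuous Rp Sq psurj fE.
- exact: prime_support_continuous Sq Rp qsurj gE.
Qed.
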